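(* Let $\mathcal{G}$ be the category of finite graphs and graph maps. There does not exist a Strøm–Hurewicz type model structure on $\mathcal{G}$; that is, there is no model structure on $\mathcal{G}$ in which the weak equivalences are the $\times$-homotopy equivalences, the cofibrations have the $\times$-homotopy extension property, and the fibrations have the $\times$-homotopy lifting property.
   Context: A graph $G$ is a pair $(V(G),E(G))$ where $E(G)$ is a set of unordered pairs $\{x,y\}$ (written $xy$) of vertices, with $x=y$ allowed (a loop); there are no multiple edges. All graphs are finite. A graph map $f:G\to H$ is a function $V(G)\to V(H)$ such that $xy\in E(G)$ implies $f(x)f(y)\in E(H)$. $\mathcal{G}$ is the category of finite graphs and graph maps. The product $G\times H$ has vertex set $V(G)\times V(H)$, and $(g,h)(g',h')\in E(G\times H)$ iff $gg'\in E(G)$ and $hh'\in E(H)$. For $n\in\mathbb{N}$, $I_n$ is the graph with vertex set $\{0,1,\dots,n\}$ and edges $ij$ for $|i-j|\le 1$ (so every vertex is looped). Two graph maps $f,g:A\to B$ are $\times$-homotopic, $f\simeq_\times g$, if for some $n\in\mathbb{N}$ there is a graph map $F:A\times I_n\to B$ with $F(a,0)=f(a)$ and $F(a,n)=g(a)$ for all $a\in V(A)$. A graph map $f:A\to B$ is a $\times$-homotopy equivalence if there is a graph map $g:B\to A$ with $gf\simeq_\times 1_A$ and $fg\simeq_\times 1_B$. A graph map $i:A\to B$ has the $\times$-homotopy extension property if for every $n\in\mathbb{N}$, every finite graph $Z$ and all graph maps $g:B\to Z$ and $F:A\times I_n\to Z$ with $F(a,0)=g(i(a))$ for all $a\in V(A)$,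 there is a graph map $G:B\times I_n\to Z$ with $G\circ(i\times 1_{I_n})=F$ and $G(b,0)=g(b)$ for all $b\in V(B)$. A graph map $p:X\to Y$ has the $\times$-homotopy lifting property if for every $n\in\mathbb{N}$, every finite graph $A$ and all graph maps $f:A\to X$ and $g:A\times I_n\to Y$ with $p(f(a))=g(a,0)$ for all $a\in V(A)$, there is a graph map $G:A\times I_n\to X$ with $G(a,0)=f(a)$ for all $a\in V(A)$ and $pG=g$. A model structure on a category is a choice of three classes of morphisms (cofibrations, fibrations, weak equivalences) such that: (1) all finite limits and finite colimits exist; (2) each of the three classes is closed under retracts (of morphisms); (3) if $gf$ is defined and two of $f,g,gf$ are weak equivalences, so is the third; (4) acyclic cofibrations (cofibrations that are weak equivalences) have the left lifting property with respect to fibrations, and cofibrations have the left lifting property with respect to acyclic fibrations (fibrations that are weak equivalences); (5) every morphism factors as a cofibration followed by an acyclic fibration, and as an acyclic cofibration followed by a fibration. *)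

(* Defs.v *)
From HB Require Import structures.
From mathcomp Require Import all_boot.

Set Implicit Arguments.
Unset Strict Implicit.
Unset Printing Implicit Defensive.

Declare Scope cat_scope.
Delimit Scope cat_scope with cat.

Record category := Category {
  Ob :> Type;
  Hom : Ob -> Ob -> Type;
  idm : forall A, Hom A A;
  comp : forall A B C, Hom B C -> Hom A B -> Hom A C;
  comp_idl : forall A B (f : Hom A B), comp (idm B) f = f;
  comp_idr : forall A B (f : Hom A B), comp f (idm A) = f;
  comp_assoc : forall A B C D (h : Hom C D) (g : Hom B C) (f : Hom A B),
    comp h (comp g f) = comp (comp h g) f
}.
Arguments Hom {c} A B.
Arguments idm {c} A.
Arguments comp {c A B C} g f.

Notation "g \o f" := (comp g f) : cat_scope.
Local Open Scope cat_scope.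

Record functor (J C : category) := Functor {
  fob :> J -> C;
  fmap : forall i j : J, Hom i j -> Hom (fob i) (fob j);
  fmap_id : forall i : J, fmap (idm i) = idm (fob i);
  fmap_comp : forall (i j k : J) (v : Hom j k) (u : Hom i j),
    fmap (v \o u) = fmap v \o fmap u
}.
Arguments fmap {J C} f {i j} u.

Definition finite_type (T : Type) : Prop :=
  exists (F : finType) (e : F -> T), bijective e.

Definition finite_category (J : category) : Prop :=
  finite_type J /\ forall i j : J, finite_type (Hom i j).

Section Limits.
Variables (J C : category) (D : functor J C).

Definition is_cone (L : C) (p : forall j : J, Hom L (D j)) : Prop :=
  forall (i j : J) (u : Hom i j), fmap D u \o p i = p j.

Definition is_limit (L : C) (p : forall j : J, Hom L (D j)) : Prop :=
  is_cone p /\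
  forall (X : C) (q : forall j : J, Hom X (D j)), is_cone q ->
    exists! h : Hom X L, forall j : J, p j \o h = q j.

Definition is_cocone (L : C) (p : forall j : J, Hom (D j) L) : Prop :=
  forall (i j : J) (u : Hom i j), p j \o fmap D u = p i.

Definition is_colimit (L : C) (p : forall j : J, Hom (D j) L) : Prop :=
  is_cocone p /\
  forall (X : C) (q : forall j : J, Hom (D j) X), is_cocone q ->
    exists! h : Hom L X, forall j : J, h \o p j = q j.

End Limits.

Definition has_finite_limits (C : category) : Prop :=
  forall (J : category) (D : functor J C), finite_category J ->
    exists (L : C) (p : forall j : J, Hom L (D j)), is_limit p.

Definition has_finite_colimits (C : category) : Prop :=
  forall (J : category) (D : functor J C), finite_category J ->
    exists (L : C) (p : forall j : J, Hom (D j) L), is_colimit p.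

Definition morphism_class (C : category) := forall A B : C, Hom A B -> Prop.

Section ModelStructure.
Variable C : category.

Definition is_retract (A B X Y : C) (f : Hom A B) (g : Hom X Y) : Prop :=
  exists (i : Hom A X) (r : Hom X A) (j : Hom B Y) (s : Hom Y B),
    [/\ r \o i = idm A, s \o j = idm B, g \o i = j \o f & f \o r = s \o g].

Definition closed_under_retracts (P : morphism_class C) : Prop :=
  forall (A B X Y : C) (f : Hom A B) (g : Hom X Y),
    is_retract f g -> P X Y g -> P A B f.

Definition two_out_of_three (P : morphism_class C) : Prop :=
  forall (X Y Z : C) (f : Hom X Y) (g : Hom Y Z),
    [/\ P X Y f -> P Y Z g -> P X Z (g \o f),
        P X Y f -> P X Z (g \o f) -> P Y Z g &
        P Y Z g -> P X Z (g \o f) -> P X Y f].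

(* i has the left lifting property with respect to p *)
Definition llp (A B X Y : C) (i : Hom A B) (p : Hom X Y) : Prop :=
  forall (f : Hom A X) (g : Hom B Y), p \o f = g \o i ->
    exists h : Hom B X, h \o i = f /\ p \o h = g.

Definition class_llp (P Q : morphism_class C) : Prop :=
  forall (A B X Y : C) (i : Hom A B) (p : Hom X Y),
    P A B i -> Q X Y p -> llp i p.

Definition factors_as (P Q : morphism_class C) : Prop :=
  forall (X Y : C) (f : Hom X Y),
    exists (Z : C) (i : Hom X Z) (p : Hom Z Y),
      [/\ P X Z i, Q Z Y p & f = p \o i].

Definition class_cap (P Q : morphism_class C) : morphism_class C :=
  fun A B f => P A B f /\ Q A B f.

Record model_structure := ModelStructure {
  cofibration : morphism_class C;
  fibration : morphism_class C;
  weak_equivalence : morphism_class C;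
  ms_limits : has_finite_limits C;
  ms_colimits : has_finite_colimits C;
  ms_retract_cof : closed_under_retracts cofibration;
  ms_retract_fib : closed_under_retracts fibration;
  ms_retract_weq : closed_under_retracts weak_equivalence;
  ms_two_out_of_three : two_out_of_three weak_equivalence;
  ms_lift_acyclic_cof :
    class_llp (class_cap cofibration weak_equivalence) fibration;
  ms_lift_acyclic_fib :
    class_llp cofibration (class_cap fibration weak_equivalence);
  ms_factor_acyclic_fib :
    factors_as cofibration (class_cap fibration weak_equivalence);
  ms_factor_acyclic_cof :
    factors_as (class_cap cofibration weak_equivalence) fibration
}.

End ModelStructure.
Arguments cofibration {C} m {A B} f.
Arguments fibration {C} m {A B} f.
Arguments weak_equivalence {C} m {A B} f.

(* The edge set is encoded as a symmetric relation; [edge x x] means that x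
   carries a loop. *)
Record graph := Graph {
  vert :> finType;
  edge : rel vert;
  edge_sym : symmetric edge
}.
Arguments edge {g} x y.

(* Finite functions and a boolean edge condition make Leibniz equality of graph
   maps coincide with pointwise equality. *)
Record graph_map (A B : graph) := GraphMap {
  gfun :> {ffun A -> B};
  gfun_edgeb : [forall x, forall y, edge x y ==> edge (gfun x) (gfun y)]
}.

HB.instance Definition _ (A B : graph) := [isSub for @gfun A B].

Lemma gfun_edge (A B : graph) (f : graph_map A B) (x y : A) :
  edge x y -> edge (f x) (f y).
Proof. by have /forallP/(_ x)/forallP/(_ y)/implyP := gfun_edgeb f. Qed.

Lemma mk_graph_map_proof (A B : graph) (f : A -> B) :
  (forall x y, edge x y -> edge (f x) (f y)) ->
  [forall x, forall y, edge x y ==> edge ([ffun x => f x] x) ([ffun x => f x] y)].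
Proof.
by move=> fP; apply/forallP=> x; apply/forallP=> y; rewrite !ffunE; apply/implyP/fP.
Qed.

Definition mk_graph_map (A B : graph) (f : A -> B)
    (fP : forall x y, edge x y -> edge (f x) (f y)) : graph_map A B :=
  GraphMap (mk_graph_map_proof fP).

Lemma mk_graph_mapE (A B : graph) (f : A -> B) fP (x : A) :
  @mk_graph_map A B f fP x = f x.
Proof. by rewrite ffunE. Qed.

Lemma graph_mapP (A B : graph) (f g : graph_map A B) :
  (forall x, f x = g x) <-> f = g.
Proof. by split=> [fg|-> //]; apply/val_inj/ffunP. Qed.

Definition graph_id (A : graph) : graph_map A A :=
  @mk_graph_map A A id (fun _ _ => id).

Definition graph_comp (A B C : graph) (g : graph_map B C) (f : graph_map A B) :
    graph_map A C :=
  @mk_graph_map A C (fun x => g (f x))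
    (fun _ _ xy => gfun_edge g (gfun_edge f xy)).

Lemma graph_comp_idl (A B : graph) (f : graph_map A B) :
  graph_comp (graph_id B) f = f.
Proof. by apply/graph_mapP=> x; rewrite !mk_graph_mapE. Qed.

Lemma graph_comp_idr (A B : graph) (f : graph_map A B) :
  graph_comp f (graph_id A) = f.
Proof. by apply/graph_mapP=> x; rewrite !mk_graph_mapE. Qed.

Lemma graph_comp_assoc (A B C D : graph) (h : graph_map C D)
    (g : graph_map B C) (f : graph_map A B) :
  graph_comp h (graph_comp g f) = graph_comp (graph_comp h g) f.
Proof. by apply/graph_mapP=> x; rewrite !mk_graph_mapE. Qed.

Definition graph_category : category :=
  Category graph_comp_idl graph_comp_idr graph_comp_assoc.

Section GraphProduct.
Variables G H : graph.

Definition prod_edge : rel (G * H)%type :=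
  fun u v => edge u.1 v.1 && edge u.2 v.2.

Lemma prod_edge_sym : symmetric prod_edge.
Proof.
by move=> u v; rewrite /prod_edge (edge_sym u.1) (edge_sym u.2).
Qed.

Definition graph_prod : graph := Graph prod_edge_sym.

End GraphProduct.

Section GraphProductMap.
Variables (A B C D : graph) (f : graph_map A B) (g : graph_map C D).

Definition prod_fun (u : graph_prod A C) : graph_prod B D := (f u.1, g u.2).

Lemma prod_fun_edge (u v : graph_prod A C) :
  edge u v -> edge (prod_fun u) (prod_fun v).
Proof.
by case/andP=> uv1 uv2; apply/andP; split; apply: gfun_edge.
Qed.

Definition graph_prod_map : graph_map (graph_prod A C) (graph_prod B D) :=
  mk_graph_map prod_fun_edge.

End GraphProductMap.

Section Interval.
Variable n : nat.

Definition interval_edge : rel 'I_n.+1 := fun i j => (i <= j.+1) && (j <= i.+1).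

Lemma interval_edge_sym : symmetric interval_edge.
Proof. by move=> i j; rewrite /interval_edge andbC. Qed.

Definition interval_graph : graph := Graph interval_edge_sym.

End Interval.

Definition times_homotopic (A B : graph) (f g : graph_map A B) : Prop :=
  exists (n : nat) (F : graph_map (graph_prod A (interval_graph n)) B),
    (forall a : A, F (a, ord0) = f a) /\ (forall a : A, F (a, ord_max) = g a).

Definition times_homotopy_equivalence (A B : graph) (f : graph_map A B) : Prop :=
  exists g : graph_map B A,
    times_homotopic (graph_comp g f) (graph_id A) /\
    times_homotopic (graph_comp f g) (graph_id B).

Definition times_HEP (A B : graph) (i : graph_map A B) : Prop :=
  forall (n : nat) (Z : graph) (g : graph_map B Z)
         (F : graph_map (graph_prod A (interval_graph n)) Z),
    (forall a : A, F (a, ord0) = g (i a)) ->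
    exists G : graph_map (graph_prod B (interval_graph n)) Z,
      graph_comp G (graph_prod_map i (graph_id (interval_graph n))) = F /\
      (forall b : B, G (b, ord0) = g b).

Definition times_HLP (X Y : graph) (p : graph_map X Y) : Prop :=
  forall (n : nat) (A : graph) (f : graph_map A X)
         (g : graph_map (graph_prod A (interval_graph n)) Y),
    (forall a : A, p (f a) = g (a, ord0)) ->
    exists G : graph_map (graph_prod A (interval_graph n)) X,
      (forall a : A, G (a, ord0) = f a) /\ graph_comp p G = g.

Definition Strom_Hurewicz_type (M : model_structure graph_category) : Prop :=
  [/\ forall (A B : graph) (f : graph_map A B),
        weak_equivalence (C := graph_category) M f <-> times_homotopy_equivalence f,
      forall (A B : graph) (f : graph_map A B),
        cofibration (C := graph_category) M f -> times_HEP f &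
      forall (A B : graph) (f : graph_map A B),
        fibration (C := graph_category) M f -> times_HLP f].

(* Main.v *)
Require Import Defs.
From HB Require Import structures.
From mathcomp Require Import all_boot.

Set Implicit Arguments.
Unset Strict Implicit.
Unset Printing Implicit Defensive.

(** A map [i : A -> B] with the homotopy extension property has an image closed
    under adjacency.  Send [B] to [I_2] by the indicator function of the image of
    [i].  On [A] this is constantly [1], hence homotopic in one step to the
    constant [2]; extend this homotopy to [B].  At its end [i a] is sent to [2], so
    at its start a neighbour of [i a] is sent to [0] or [1] and to a neighbour of
    [2], that is to [1]: it lies in the image.  A map [p] with the homotopy lifting
    property lifts looped neighbours of [p x] to neighbours of [x], for [x] looped.
    So if [f] is a map of the first kind followed by one of the second, every
    looped neighbour of [f a], for [a] looped, is in the image of [f].  This fails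
    for the inclusion of an endpoint into [I_1]. *)

Lemma interval_edge_refl (n : nat) (t : interval_graph n) : edge t t.
Proof. by apply/andP. Qed.

Lemma interval1_edge (s t : interval_graph 1) : edge s t.
Proof. by case: s t => [[|[|?]] ?] [[|[|?]] ?]. Qed.

Definition const_graph_map (A B : graph) (b : B) (bb : edge b b) : graph_map A B :=
  @mk_graph_map A B (fun=> b) (fun _ _ _ => bb).

(** Edges of the exponential graph [B^A]; homotopies of length one are exactly
    such edges. *)
Definition times_adjacent (A B : graph) (f g : graph_map A B) : Prop :=
  forall x y, edge x y -> edge (f x) (g y).

Section HomotopyStage.
Variables (A B : graph) (n : nat).
Variable F : graph_map (graph_prod A (interval_graph n)) B.

Lemma homotopy_edge (s t : interval_graph n) (x y : A) :
  edge s t -> edge x y -> edge (F (x, s)) (F (y, t)).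
Proof. by move=> st xy; apply: gfun_edge; apply/andP. Qed.

Definition homotopy_stage (t : interval_graph n) : graph_map A B :=
  mk_graph_map (fun x y => @homotopy_edge t t x y (interval_edge_refl t)).

Lemma homotopy_stageE (t : interval_graph n) (x : A) :
  homotopy_stage t x = F (x, t).
Proof. exact: mk_graph_mapE. Qed.

Lemma times_adjacent_stage (s t : interval_graph n) :
  edge s t -> times_adjacent (homotopy_stage s) (homotopy_stage t).
Proof. by move=> st x y xy; rewrite !homotopy_stageE; apply: homotopy_edge. Qed.

End HomotopyStage.

Section AdjacencyHomotopy.
Variables (A B : graph) (f g : graph_map A B).
Hypothesis fg : times_adjacent f g.

Definition adjacency_fun (u : graph_prod A (interval_graph 1)) : B :=
  if u.2 == ord0 then f u.1 else g u.1.

Lemma adjacency_fun_edge (u v : graph_prod A (interval_graph 1)) :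
  edge u v -> edge (adjacency_fun u) (adjacency_fun v).
Proof.
case/andP=> uv _; rewrite /adjacency_fun; case: ifP => _; case: ifP => _.
- exact: gfun_edge.
- exact: fg.
- by rewrite edge_sym fg // edge_sym.
- exact: gfun_edge.
Qed.

Definition adjacency_homotopy : graph_map (graph_prod A (interval_graph 1)) B :=
  mk_graph_map adjacency_fun_edge.

Lemma adjacency_homotopy0 (x : A) : adjacency_homotopy (x, ord0) = f x.
Proof. exact: mk_graph_mapE. Qed.

Lemma adjacency_homotopy1 (x : A) : adjacency_homotopy (x, ord_max) = g x.
Proof. exact: mk_graph_mapE. Qed.

End AdjacencyHomotopy.

Lemma times_HEP_extend_adjacent (A B Z : graph) (i : graph_map A B)
    (g : graph_map B Z) (f : graph_map A Z) :
  times_HEP i -> times_adjacent (graph_comp g i) f ->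
  exists2 h, times_adjacent g h & graph_comp h i = f.
Proof.
move=> hep gif.
have start a : adjacency_homotopy gif (a, ord0) = g (i a).
  by rewrite adjacency_homotopy0 mk_graph_mapE.
have [G [Gi G0]] := hep _ _ _ _ start.
exists (homotopy_stage G ord_max).
  have <- : homotopy_stage G ord0 = g by apply/graph_mapP=> b; rewrite homotopy_stageE.
  exact/times_adjacent_stage/interval1_edge.
apply/graph_mapP=> a; rewrite -(adjacency_homotopy1 gif) -Gi.
by rewrite !mk_graph_mapE /prod_fun mk_graph_mapE.
Qed.

Lemma times_HLP_lift_adjacent (A X Y : graph) (p : graph_map X Y)
    (f : graph_map A X) (g : graph_map A Y) :
  times_HLP p -> times_adjacent (graph_comp p f) g ->
  exists2 h, times_adjacent f h & graph_comp p h = g.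
Proof.
move=> hlp pfg.
have start a : p (f a) = adjacency_homotopy pfg (a, ord0).
  by rewrite adjacency_homotopy0 mk_graph_mapE.
have [G [G0 pG]] := hlp _ _ _ _ start.
exists (homotopy_stage G ord_max).
  have <- : homotopy_stage G ord0 = f by apply/graph_mapP=> a; rewrite homotopy_stageE.
  exact/times_adjacent_stage/interval1_edge.
by apply/graph_mapP=> a; rewrite -(adjacency_homotopy1 pfg) -pG !mk_graph_mapE.
Qed.

Section Indicator.
Variables (B : graph) (S : {pred B}).

Definition indicator_fun (b : B) : interval_graph 2 := inord (b \in S).

Lemma val_indicator_fun (b : B) : indicator_fun b = (b \in S) :> nat.
Proof. by rewrite inordK //; case: (b \in S). Qed.

Lemma indicator_fun_edge (b c : B) :
  edge b c -> edge (indicator_fun b) (indicator_fun c).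
Proof.
by move=> _; rewrite /= /interval_edge !val_indicator_fun; do 2!case: (_ \in S).
Qed.

Definition indicator_map : graph_map B (interval_graph 2) :=
  mk_graph_map indicator_fun_edge.

Lemma indicator_map_edge_max (b : B) :
  edge (indicator_map b) (ord_max : interval_graph 2) = (b \in S).
Proof.
by rewrite mk_graph_mapE /= /interval_edge val_indicator_fun; case: (b \in S).
Qed.

End Indicator.

Lemma times_HEP_codom_closed (A B : graph) (i : graph_map A B) :
  times_HEP i -> closed edge (codom i).
Proof.
move=> hep; apply: intro_closed; first exact/sym_connect_sym/edge_sym.
move=> x b + /codomP[a xE]; rewrite {x}xE => iab.
pose two := const_graph_map A (interval_edge_refl (ord_max : interval_graph 2)).
have adj_two : times_adjacent (graph_comp (indicator_map [in codom i]) i) two.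
  move=> x y _; rewrite mk_graph_mapE [two y]mk_graph_mapE.
  by rewrite indicator_map_edge_max codom_f.
have [h adj_h /graph_mapP/(_ a)] := times_HEP_extend_adjacent hep adj_two.
rewrite !mk_graph_mapE => hia.
have := adj_h b (i a); rewrite hia indicator_map_edge_max.
by apply; rewrite edge_sym.
Qed.

Lemma times_HLP_lift_neighbour (X Y : graph) (p : graph_map X Y) (x : X) (y : Y) :
  times_HLP p -> edge x x -> edge y y -> edge (p x) y ->
  exists2 x', edge x x' & p x' = y.
Proof.
move=> hlp xx yy pxy; pose point := interval_graph 0.
have adj : times_adjacent (graph_comp p (const_graph_map point xx))
                          (const_graph_map point yy).
  by move=> s t _; rewrite !mk_graph_mapE.
have [h adj_h /graph_mapP/(_ ord0)] := times_HLP_lift_adjacent hlp adj.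
rewrite !mk_graph_mapE => ph; exists (h ord0) => //.
by have := adj_h ord0 ord0 (interval_edge_refl _); rewrite mk_graph_mapE.
Qed.

Lemma times_HEP_HLP_comp_codom_closed (A Z B : graph) (i : graph_map A Z)
    (p : graph_map Z B) (a : A) (b : B) :
  times_HEP i -> times_HLP p -> edge a a -> edge b b ->
  edge (graph_comp p i a) b -> b \in codom (graph_comp p i).
Proof.
move=> hep hlp aa bb; rewrite mk_graph_mapE => piab.
have [z iaz <-] := times_HLP_lift_neighbour hlp (gfun_edge i aa) bb piab.
have /codomP[c ->] : z \in codom i.
  by rewrite -(times_HEP_codom_closed hep iaz) codom_f.
by apply/codomP; exists c; rewrite mk_graph_mapE.
Qed.

Theorem theorem2p11 :
  ~ (exists M : model_structure graph_category, Strom_Hurewicz_type M).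
Proof.
case=> M [_ cofP fibP].
pose endpoint : graph_map (interval_graph 0) (interval_graph 1) :=
  const_graph_map _ (interval_edge_refl ord0).
have [Z [i [p [[cof_i _] fib_p piE]]]] := ms_factor_acyclic_cof M endpoint.
have : (ord_max : interval_graph 1) \in codom endpoint.
  rewrite piE; apply: (times_HEP_HLP_comp_codom_closed (a := ord0 : interval_graph 0)).
  - exact: cofP cof_i.
  - exact: fibP fib_p.
  - exact: interval_edge_refl.
  - exact: interval_edge_refl.
  - exact: interval1_edge.
by case/codomP=> s; rewrite mk_graph_mapE.
Qed.
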